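(* Let $d\ge1$ and let $G$ be a $d$-regular $3$-partite $3$-uniform hypergraph whose three vertex classes each have size $d$. Then $\chi_l(G)\le 0.78\log_3 d+3$.
   Context: A $3$-partite $3$-uniform hypergraph has vertex classes $V_1,V_2,V_3$ and each edge consists of one vertex from each class. $\chi_l(G)$ is the list chromatic number: the least $k$ such that whenever each vertex $v$ is given a list $L(v)$ of at least $k$ colours, one can choose $c(v)\in L(v)$ for all $v$ so that no edge has all three vertices of the same colour. *)

(* Defs.v *)
From HB Require Import structures.
From mathcomp Require Import all_boot.
From mathcomp Require Import boolp.
Set Implicit Arguments.
Unset Strict Implicit.
Unset Printing Implicit Defensive.

Record hypergraph3 (V : finType) := Hypergraph3 {
  edges : {set {set V}};
  card_edge : forall e, e \in edges -> #|e| = 3 }.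

Definition tripartite (V : finType) (G : hypergraph3 V) (V1 V2 V3 : {set V}) :
    Prop :=
  [/\ V1 :|: V2 :|: V3 = [set: V],
      [/\ [disjoint V1 & V2], [disjoint V1 & V3] & [disjoint V2 & V3]]
    & forall e, e \in edges G ->
        [/\ #|e :&: V1| = 1, #|e :&: V2| = 1 & #|e :&: V3| = 1]].

Definition degree (V : finType) (G : hypergraph3 V) (v : V) : nat :=
  #|[set e in edges G | v \in e]|.

Definition regular (V : finType) (G : hypergraph3 V) (d : nat) : Prop :=
  forall v, degree G v = d.

Definition monochromatic (V C : finType) (c : V -> C) (e : {set V}) : Prop :=
  exists a, forall v, v \in e -> c v = a.

(* Quantifying over finite palettes C loses nothing: V is finite, and an
   infinite list may be replaced by any k of its colours. *)
Definition choosable (V : finType) (G : hypergraph3 V) (k : nat) : Prop :=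
  forall (C : finType) (L : V -> {set C}), (forall v, k <= #|L v|) ->
  exists c : V -> C, (forall v, c v \in L v) /\
    (forall e, e \in edges G -> ~ monochromatic c e).

Lemma distinct_representatives (V C : finType) (L : V -> {set C}) :
  (forall v, #|V| <= #|L v|) ->
  exists2 c : V -> C, injective c & forall v, c v \in L v.
Proof.
move=> hL.
have [/card0_eq V0|] := posnP #|V|.
  have F : V -> False by move=> v; have := V0 v; rewrite inE.
  by exists (fun v => False_rect C (F v)) => v; case: (F v).
case/card_gt0P=> v0 _.
have /card_gt0P[a0 _] : 0 < #|L v0|.
  by apply: leq_trans (hL v0); apply/card_gt0P; exists v0.
suff /(_ (enum V) (enum_uniq V))[c cinj cL] : forall s : seq V, uniq s ->
    exists2 c : V -> C, {in s &, injective c} & {in s, forall v, c v \in L v}.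
  exists c => [u v|v]; last by apply: cL; rewrite mem_enum.
  by apply: cinj; rewrite mem_enum.
elim=> [_|v s IHs /= /andP[vs us]]; first by exists (fun=> a0).
have [c cinj cL] := IHs us.
have /subsetPn[a aL aN] : ~~ (L v \subset [set x in map c s]).
  apply/negP => /subset_leq_card; apply/negP; rewrite -ltnNge.
  apply: leq_trans (hL v); apply: (@leq_ltn_trans (size s)).
    by rewrite cardsE (leq_trans (card_size _)) ?size_map.
  have <- : #|v :: s| = (size s).+1 by apply/card_uniqP; rewrite /= vs.
  exact: max_card.
rewrite inE in aN.
have cN u : u \in s -> c u != a.
  by move=> us'; apply: contraNneq aN => <-; apply: map_f.
exists (fun u => if u == v then a else c u) => [u w|u]; rewrite !inE.
  case: (eqVneq u v) => [->|_] /=; case: (eqVneq w v) => [->|_] //= h1 h2.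
  - by move=> /esym/eqP; rewrite (negPf (cN _ h2)).
  - by move=> /eqP; rewrite (negPf (cN _ h1)).
  - exact: cinj.
by case: (eqVneq u v) => [->|_] //= /cL.
Qed.

Lemma ex_choosable (V : finType) (G : hypergraph3 V) :
  exists k, `[< choosable G k >].
Proof.
exists #|V|; apply/asboolP => C L /distinct_representatives[c cinj cL].
exists c; split=> // e /card_edge e3 [a ca].
have /card_gt1P[u [v [ue ve /eqP]]] : 1 < #|e| by rewrite e3.
by apply; apply: cinj; rewrite !ca.
Qed.

Definition list_chromatic_number (V : finType) (G : hypergraph3 V) : nat :=
  ex_minn (ex_choosable G).

(* Main.v *)
(** Give every colour an independent random type, which fixes for each of the
    three classes how much vertices of that class like the colour; every vertex
    takes a colour it likes best from its list.  Scale the liking so that it is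
    45 times its own distribution function, and put q = 11/45.

    If an edge is monochromatic in a colour of type (x1, x2, x3), then for each
    i its vertex in class i likes no colour of its list more than xi.  Either
    some xi is 11, and a given vertex has this misfortune with probability at
    most q^k for lists of size k; or x1 x2 x3 <= 45^3 q^2 and, by negative
    dependence at (x1, x2, x3) (which matters because the three lists may
    overlap), the probability is at most q^(2k) for a given edge and type.
    There are 3d vertices, d^2 edges and 9 types of the second kind, and
    q <= 3^(-1/0.78), so d q^k <= q^2 and 3 q^2 + 9 q^4 < 1 for some
    k <= 0.78 log_3 d + 3. *)

Require Import Defs.
From mathcomp Require Import all_boot all_order all_algebra.
From mathcomp Require Import reals exp lra.
Import Order.TTheory GRing.Theory Num.Theory.
Local Open Scope ring_scope.

(** * The distribution of types and its finite checks *)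

(* Each row is a type: its probability times 45, and the levels of the three
   classes.  The levels and weights make the level at each class equal to 45
   times its own distribution function, with the single atom 11 as forbidden
   level; the rotations make the classes interchangeable. *)
Definition type_table : seq (nat * seq nat) := [::
  (11, [:: 11; 45; 45]); (11, [:: 45; 11; 45]); (11, [:: 45; 45; 11]);
  (2, [:: 13; 19; 22]); (2, [:: 22; 13; 19]); (2, [:: 19; 22; 13]);
  (1, [:: 14; 15; 23]); (1, [:: 23; 14; 15]); (1, [:: 15; 23; 14]);
  (1, [:: 16; 17; 20]); (1, [:: 20; 16; 17]); (1, [:: 17; 20; 16])]%N.

Definition weight (t : 'I_12) : nat := (nth (0, [::]) type_table t).1.

Definition level (t : 'I_12) (i : 'I_3) : nat :=
  nth 0%N (nth (0%N, [::]) type_table t).2 i.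

Lemma sum_weight : (\sum_t weight t = 45)%N.
Proof. by rewrite !big_ord_recl big_ord0. Qed.

Lemma weight_forbidden (i : 'I_3) :
  (\sum_(t | level t i <= 11) weight t = 11)%N.
Proof.
rewrite big_mkcond !big_ord_recl big_ord0.
by case: i => [[|[|[|//]]] hi].
Qed.

Lemma exists_level_eq11 (t : 'I_12) : (t < 3)%N -> exists i, level t i = 11%N.
Proof.
(* Row [t] has its 11 in column [t]. *)
move=> t3; exists (Ordinal t3).
by case: t t3 => [[|[|[|//]]]] ? ?.
Qed.

(** Negative dependence, by a finite check: levels being 45 times distribution functions, the right
    side is 45^3 times the product of the marginal probabilities. [S] will be the classes whose
    lists contain a given colour. *)
Lemma weight_lower_orthant_le (t : 'I_12) (S : pred 'I_3) : (2 < t)%N ->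
  (45 ^ 2 * \sum_(u | [forall i, S i ==> (level u i <= level t i)]) weight u
   <= \prod_i if S i then level t i else 45)%N.
Proof.
move=> t2.
under eq_bigl => u do rewrite -big_andE big_mkcond !big_ord_recl big_ord0.
rewrite big_mkcond !big_ord_recl !big_ord0 /=.
move: (S ord0) (S (lift ord0 ord0)) (S (lift ord0 (lift ord0 ord0))).
case: t t2 => [[|[|[|m]]]] //.
do 9?[case: m => [|m]]=> //.
all: by move=> ? _ [] [] []; vm_compute.
Qed.

Lemma prod_level (t : 'I_12) : (2 < t)%N ->
  (\prod_i level t i <= 11 ^ 2 * 45)%N.
Proof.
rewrite !big_ord_recl big_ord0.
by case: t => [[|[|[|[|[|[|[|[|[|[|[|[|//]]]]]]]]]]]]].
Qed.

(** * Product measures and the union bound *)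

Definition prod_mass {R : realFieldType} {C T : finType} (mu : T -> R)
    (E : pred {ffun C -> T}) : R :=
  \sum_(f | E f) \prod_c mu (f c).

Lemma prod_mass_forall {R : realFieldType} {C T : finType} (mu : T -> R)
    (P : C -> pred T) :
  prod_mass mu (fun f => [forall c, P c (f c)])
  = \prod_c \sum_(t | P c t) mu t.
Proof. by rewrite bigA_distr_big_dep; apply: eq_bigl. Qed.

Lemma prod_mass_le {R : realFieldType} {C T : finType} (mu : T -> R)
    {E F : pred {ffun C -> T}} :
  (forall t, 0 <= mu t) -> subpred E F ->
  prod_mass mu E <= prod_mass mu F.
Proof.
move=> mu0 EF; rewrite /prod_mass big_mkcond [leRHS]big_mkcond.
apply: ler_sum => f _; have p0 : 0 <= \prod_c mu (f c) by apply: prodr_ge0.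
by case: ifP => [/EF ->|_] //; case: ifP.
Qed.

Lemma union_bound {R : realFieldType} {C T I : finType} (mu : T -> R)
    (D : pred I) (E : I -> pred {ffun C -> T}) :
  (forall t, 0 <= mu t) -> \sum_t mu t = 1 ->
  \sum_(i | D i) prod_mass mu (E i) < 1 ->
  exists f, forall i, D i -> ~~ E i f.
Proof.
move=> mu0 mu1 lt_1.
have [/existsP[f /forall_inP Hf]|/existsPn noF] :=
  boolP [exists f, [forall (i | D i), ~~ E i f]]; first by exists f.
suff : 1 <= \sum_(i | D i) prod_mass mu (E i) by rewrite leNgt lt_1.
have <- : prod_mass mu (predT : pred {ffun C -> T}) = 1.
  transitivity (\prod_(c : C) \sum_t mu t); last by apply: big1.
  by rewrite -(prod_mass_forall mu (fun=> predT)); apply: eq_bigl => f;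
     apply/esym/forallP.
rewrite /prod_mass (exchange_big_dep predT) //=; apply: ler_sum => f _.
have /forall_inPn[i Di /negPn Ei] := noF f.
rewrite (bigD1 i) /=; last by apply/andP.
rewrite lerDl; apply: sumr_ge0 => j _.
exact: prodr_ge0.
Qed.

(** * Probabilities of the bad events *)

Definition mass (R : realFieldType) (t : 'I_12) : R := (weight t)%:R / 45.

Lemma mass_ge0 (R : realFieldType) t : 0 <= mass R t.
Proof. by rewrite /mass divr_ge0 ?ler0n. Qed.

Lemma sum_mass (R : realFieldType) (P : pred 'I_12) :
  \sum_(t | P t) mass R t = (\sum_(t | P t) weight t)%:R / 45.
Proof. by rewrite -mulr_suml natr_sum. Qed.

Lemma prod_if_mem (R : realFieldType) (C : finType) (A : {set C}) (x : R) :
  \prod_c (if c \in A then x else 1) = x ^+ #|A|.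
Proof. by rewrite -big_mkcond prodr_const. Qed.

Lemma prob_all_forbidden (R : realFieldType) (C : finType) (A : {set C})
    (i : 'I_3) k :
  (k <= #|A|)%N ->
  prod_mass (mass R)
    (fun f => [forall c, (c \in A) ==> (level (f c) i <= 11)%N])
  <= (11 / 45) ^+ k.
Proof.
move=> kA; rewrite (prod_mass_forall (mass R)
  (fun c t => (c \in A) ==> (level t i <= 11)%N)).
apply: le_trans (_ : (11 / 45) ^+ #|A| <= _); last first.
  by apply: ler_wiXn2l => //; lra.
rewrite -prod_if_mem le_eqVlt; apply/orP; left; apply/eqP/eq_bigr => c _.
case: (c \in A) => /=; rewrite sum_mass; first by rewrite weight_forbidden.
by rewrite sum_weight divff // pnatr_eq0.
Qed.

(** Independence factors the probability over colours, and negative dependence splits each factor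
    over classes. Regrouping by class gives at most the product of the [x i ^+ k], and [prod_level]
    bounds the product of the [x i] by (11/45)^2. *)
Lemma prob_edge_below (R : realFieldType) {C : finType} {A : 'I_3 -> {set C}}
    {t : 'I_12} {k} :
  (2 < t)%N -> (forall i, k <= #|A i|)%N ->
  prod_mass (mass R) (fun f =>
    [forall c, [forall i, (c \in A i) ==> (level (f c) i <= level t i)%N]])
  <= (11 / 45) ^+ (2 * k).
Proof.
move=> t2 kA; rewrite (prod_mass_forall (mass R)
  (fun c u => [forall i, (c \in A i) ==> (level u i <= level t i)%N])).
have lev45 i : (level t i <= 45)%N.
  by case: t t2 i => [[|[|[|[|[|[|[|[|[|[|[|[|//]]]]]]]]]]]] ?] _ [[|[|[|//]]] ?].
pose x i : R := (level t i)%:R / 45.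
have x0 i : 0 <= x i by rewrite divr_ge0 ?ler0n.
have x1 i : x i <= 1 by rewrite ler_pdivrMr ?mul1r ?ler_nat ?lev45 // ltr0n.
apply: le_trans (_ : \prod_c \prod_i (if c \in A i then x i else 1) <= _).
  apply: ler_prod => c _; apply/andP; split.
    by apply: sumr_ge0 => u _; apply: mass_ge0.
  have := weight_lower_orthant_le t (fun i => c \in A i) t2.
  rewrite sum_mass -(ler_nat R) natrM natr_prod.
  set m := (_%:R in X in _ * X <= _ -> _); move=> h.
  have -> : \prod_i (if c \in A i then x i else 1) =
      (\prod_i (if c \in A i then level t i else 45%N)%:R) / 45 ^+ 3 :> R.
    have -> : 45 ^+ 3 = \prod_(i < 3) 45 :> R by rewrite prodr_const card_ord.
    rewrite -prodf_div.
    apply: eq_bigr => i _; case: ifP => // _.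
    by rewrite divff // pnatr_eq0.
  move: h; set y := \prod_i _; rewrite natrX; lra.
rewrite exchange_big /=.
apply: le_trans (_ : (\prod_i x i) ^+ k <= _).
  rewrite -prodrXl; apply: ler_prod => i _; rewrite prod_if_mem exprn_ge0 //=.
  exact: ler_wiXn2l.
rewrite exprM; apply: lerXn2r; rewrite ?nnegrE ?exprn_ge0 ?prodr_ge0 //; first lra.
rewrite prodf_div prodr_const card_ord -natr_prod.
have := prod_level t t2; rewrite -(ler_nat R) natrM natrX.
set y := (_%:R in X in X <= _ -> _); lra.
Qed.

(** * From the probability bounds to choosability *)

Lemma choosable_of_counts (R : realFieldType) {V : finType}
    {G : hypergraph3 V} {cls : V -> 'I_3} {k : nat} :
  (forall e, e \in edges G ->
    exists g : 'I_3 -> V, forall i, g i \in e /\ cls (g i) = i) ->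
  (0 < k)%N ->
  #|V|%:R * (11 / 45) ^+ k + 9 * #|edges G|%:R * (11 / 45) ^+ (2 * k)
    < 1 :> R ->
  choosable G k.
Proof.
move=> trans k0 lt_1 C L hL.
(* Bad events: a vertex has only colours at the forbidden level, or, for an edge and a type of the
   second kind, no colour listed at a vertex of the edge exceeds the level of that type there. *)
pose D (i : V + {set V} * 'I_12) :=
  if i is inr p then (p.1 \in edges G) && (2 < p.2)%N else true.
pose E (i : V + {set V} * 'I_12) (f : {ffun C -> 'I_12}) :=
  match i with
  | inl v => [forall c, (c \in L v) ==> (level (f c) (cls v) <= 11)%N]
  | inr p => [forall v in p.1, forall c in L v,
      (level (f c) (cls v) <= level p.2 (cls v))%N]
  end.
have [f Hf] : exists f, forall i, D i -> ~~ E i f.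
  apply: (union_bound (mass R)).
  - exact: mass_ge0.
  - by rewrite sum_mass sum_weight divff // pnatr_eq0.
  apply: le_lt_trans lt_1; rewrite big_sumType /=; apply: lerD.
    apply: le_trans (_ : \sum_(v : V) (11 / 45) ^+ k <= _).
      by apply: ler_sum => v _; apply: prob_all_forbidden.
    by rewrite sumr_const -[leLHS]mulr_natl.
  apply: le_trans (_ :
      \sum_(e in edges G) \sum_(t < 12 | (2 < t)%N) (11 / 45) ^+ (2 * k) <= _).
    rewrite pair_big; refine (ler_sum _ _) => -[e t] /= /andP[eG t2].
    have [g Hg] := trans e eG.
    apply: le_trans (prob_edge_below R t2 (fun i => hL (g i))).
    apply: prod_mass_le; first exact: mass_ge0.
    move=> f /= /forall_inP Ef; apply/forallP => c; apply/forallP => i.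
    apply/implyP => ci; have [gi ki] := Hg i.
    by have /forall_inP/(_ c ci) := Ef _ gi; rewrite ki.
  rewrite sumr_const sumr_const.
  have -> : #|[pred t : 'I_12 | (2 < t)%N]| = 9%N.
    by rewrite -sum1_card big_mkcond !big_ord_recl big_ord0.
  by rewrite -mulrnA -[leLHS]mulr_natl natrM.
have Lne v : exists a, a \in L v.
  by apply/card_gt0P; apply: leq_trans k0 (hL v).
have max v : exists a, (a \in L v) && [forall c in L v,
    (level (f c) (cls v) <= level (f a) (cls v))%N].
  have [a0 a0L] := Lne v.
  have [a aL amax] := arg_maxnP (fun c => level (f c) (cls v)) a0L.
  by exists a; apply/andP; split=> //; apply/forall_inP.
exists (fun v => xchoose (max v)); split.
  by move=> v; have /andP[] := xchooseP (max v).
move=> e eG [a mono].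
have below v c : v \in e -> c \in L v ->
    (level (f c) (cls v) <= level (f a) (cls v))%N.
  move=> ve cL; rewrite -(mono v ve).
  by have /andP[_ /forall_inP] := xchooseP (max v); apply.
(* If [f a] has a level 11, the edge triggers the event of its vertex in that class; otherwise it
   triggers its own event at type [f a]. *)
have [t3|t2] := ltnP (f a) 3.
  have [i fi] := exists_level_eq11 (f a) t3; have [g /(_ i)[gi ki]] := trans e eG.
  have /negP := Hf (inl (g i)) isT; apply; apply/forall_inP => c cL.
  by have := below _ _ gi cL; rewrite ki fi.
have /negP := Hf (inr (e, f a)) (introT andP (conj eG t2)); apply.
by apply/forall_inP => v ve; apply/forall_inP => c; apply: below.
Qed.

(** * The numerical bound on the list size *)

Lemma ln_ratio_bound (R : realType) :
  50 / 39 * ln (3 : R) <= ln (45 / 11 : R).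
Proof.
(* Since 45 = 3^2 * 5, this amounts to [11 ^ 39 <= 3 ^ 28 * 5 ^ 39], which holds with
   little to spare. *)
have e45 : 45 = 3 ^+ 2 * 5 :> R by lra.
have q45 : 0 < 45 / 11 :> R by lra.
have h2 : 3 ^+ 50 <= (45 / 11) ^+ 39 :> R.
  rewrite expr_div_n ler_pdivlMr ?exprn_gt0 //.
  have -> : 45 ^+ 39 = 3 ^+ 50 * (3 ^+ 28 * 5 ^+ 39) :> R.
    by rewrite e45 exprMn -exprM mulrA -exprD (_ : 2 * 39 = 50 + 28)%N.
  by rewrite ler_wpM2l ?exprn_ge0 //; lra.
move: h2; rewrite -ler_ln ?posrE ?exprn_gt0 // !lnXn //; lra.
Qed.

(** Two of the [k] factors give the right side; the other k - 2 absorb [d], because 3^(50/39) <=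
    45/11 and 50/39 = 1/0.78. *)
Lemma mul_expr_le_sqr (R : realType) (d k : nat) : (0 < d)%N ->
  78 / 100 * (ln (d%:R : R) / ln 3) + 2 <= k%:R ->
  d%:R * (11 / 45) ^+ k <= (11 / 45) ^+ 2 :> R.
Proof.
move=> d0 hk.
have l3 : 0 < ln (3 : R) by apply: ln_gt0; lra.
have ld : 0 <= ln (d%:R : R) by apply: ln_ge0; rewrite ler1n.
have d0R : 0 < d%:R :> R by rewrite ltr0n.
have k2 : (2 <= k)%N.
  rewrite -(ler_nat R); apply: le_trans hk; rewrite lerDr.
  by rewrite mulr_ge0 ?divr_ge0 // ltW.
move: hk; rewrite -(subnK k2); move: (k - 2)%N => m; rewrite natrD => hm.
rewrite exprD mulrA ler_piMl ?exprn_ge0 //; first lra.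
have q45 : 0 < 45 / 11 :> R by lra.
have -> : 11 / 45 = (45 / 11)^-1 :> R by rewrite invf_div.
rewrite exprVn ler_pdivrMr ?exprn_gt0 // mul1r.
rewrite -ler_ln ?posrE ?exprn_gt0 // lnXn //.
apply: le_trans (_ : 50 / 39 * ln 3 * m%:R <= _); last first.
  by rewrite -[leRHS]mulr_natr ler_wpM2r // ln_ratio_bound.
have : 78 / 100 * ln (d%:R : R) <= m%:R * ln 3.
  by rewrite -ler_pdivrMr // -mulrA; lra.
lra.
Qed.

(** * Counting vertices and edges, and the conclusion *)

Lemma card_tripartite {V : finType} {G : hypergraph3 V} {V1 V2 V3 : {set V}} :
  tripartite G V1 V2 V3 -> #|V| = (#|V1| + #|V2| + #|V3|)%N.
Proof.
case=> VE [d12 d13 d23] _.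
by rewrite -cardsT -VE !cardsU setIUl !disjoint_setI0 // setU0 cards0 !subn0.
Qed.

(** Double counting of incidences: each edge meets [V1] exactly once. *)
Lemma card_edges_tripartite {V : finType} {G : hypergraph3 V}
    {V1 V2 V3 : {set V}} {d} :
  tripartite G V1 V2 V3 -> regular G d -> #|edges G| = (#|V1| * d)%N.
Proof.
case=> _ _ He reg.
rewrite -sum_nat_const -(eq_bigr _ (fun v _ => reg v)).
under eq_bigr => v _ do rewrite /degree -sum1_card.
under eq_bigr => v _ do under eq_bigl => e do rewrite inE.
rewrite (exchange_big_dep (mem (edges G))) /=; last by move=> v e _ /andP[].
rewrite -sum1_card; apply: eq_bigr => e eG.
have [e1 _ _] := He e eG; rewrite sum1_card -[LHS]e1.
by apply: eq_card => v; rewrite !inE eG andbC.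
Qed.

Lemma tripartite_class {V : finType} {G : hypergraph3 V}
    {V1 V2 V3 : {set V}} :
  tripartite G V1 V2 V3 ->
  exists cls : V -> 'I_3, forall e, e \in edges G ->
    exists g : 'I_3 -> V, forall i, g i \in e /\ cls (g i) = i.
Proof.
case=> _ [d12 d13 d23] He.
pose cls v : 'I_3 := inord (if v \in V1 then 0 else if v \in V2 then 1 else 2).
exists cls => e eG.
apply: (@fin_all_exists _ (fun=> V) (fun i v => v \in e /\ cls v = i)) => i.
have [e1 e2 e3] := He e eG.
have pick (A : {set V}) : #|e :&: A| = 1%N -> exists v, v \in e /\ v \in A.
  move=> eA; have /card_gt0P[v] : (0 < #|e :&: A|)%N by rewrite eA.
  by rewrite inE => /andP[]; exists v.
case: i => [[|[|[|//]]] i3].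
- have [v [ve v1]] := pick _ e1; exists v; split=> //.
  by apply: val_inj; rewrite /cls v1 /= inordK.
- have [v [ve v2]] := pick _ e2; exists v; split=> //.
  by apply: val_inj; rewrite /cls (disjointFl d12 v2) v2 /= inordK.
- have [v [ve v3]] := pick _ e3; exists v; split=> //.
  by apply: val_inj; rewrite /cls (disjointFl d13 v3) (disjointFl d23 v3) /= inordK.
Qed.

Theorem theorem3p1 (R : realType) (d : nat) (hd : (1 <= d)%N)
    (V : finType) (V1 V2 V3 : {set V}) (G : hypergraph3 V)
    (hG : tripartite G V1 V2 V3)
    (hV1 : #|V1| = d) (hV2 : #|V2| = d) (hV3 : #|V3| = d)
    (hreg : regular G d) :
  (list_chromatic_number G)%:R
    <= 78%:R / 100%:R * (ln (d%:R : R) / ln (3%:R : R)) + 3%:R.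
Proof.
set x := 78 / 100 * _.
have x0 : 0 <= x.
  by rewrite mulr_ge0 // divr_ge0 // ln_ge0 // ler1n.
(* The integer in (x + 2, x + 3]: the lower end serves [mul_expr_le_sqr], the upper end is the
   claimed bound. *)
set k := (Num.truncn (x + 2)).+1.
have /andP[kx xk] : k%:R <= x + 3 < k%:R + 1.
  have /andP[] := truncn_itv (addr_ge0 x0 (ler0n R 2)).
  rewrite /k -!natr1; lra.
apply: le_trans kx; rewrite ler_nat /list_chromatic_number.
case: ex_minnP => m _; apply; apply/boolp.asboolP.
have [cls Hcls] := tripartite_class hG.
apply: (choosable_of_counts R Hcls) => //.
have small : d%:R * (11 / 45) ^+ k <= (11 / 45) ^+ 2 :> R.
  by apply: mul_expr_le_sqr => //; rewrite -/x; lra.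
have y0 : 0 <= d%:R * (11 / 45) ^+ k :> R by rewrite mulr_ge0 ?exprn_ge0 //; lra.
rewrite (card_tripartite hG) hV1 hV2 hV3.
rewrite (card_edges_tripartite hG hreg) hV1.
rewrite [(2 * k)%N]mulnC exprM !natrD natrM.
move: small y0; set y := _ ^+ k => small y0.
(* The left side is 3 (d y) + 9 (d y)^2 with d y <= (11/45)^2. *)
have := ler_pM y0 y0 small small; lra.
Qed.
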